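(* For any rational function $g$, any sufficiently large $R>0$, and any sufficiently small $\epsilon>0$, there is a constant $K>0$ such that for any rational function $h$, if $\rho_h(0)<K$ and $h(0)$ is finite and non-zero, then the following holds: 1. If $z$ is a critical point of $g$ with multiplicity $m$, then there are exactly $m$ critical points of $g\cdot h$ lying within $\epsilon$ of $z$. 2. Other than those described in item 1 (the critical points of $g\cdot h$ lying within $\epsilon$ of some critical point of $g$), there are no critical points of $g\cdot h$ which lie in the disk centered at the origin with radius $R$.
   Context: Rational functions are elements of $\mathbb{C}(z)$. For a rational function $h$, let $Z_h$ and $P_h$ denote the collections of the distinct finite zeros and distinct finite poles of $h$, respectively. For $w\in Z_h\cup P_h$, $\mathrm{mult}_h(w)$ denotes the multiplicity of $w$ as a zero or pole of $h$ (positive if a zero, and negative if a pole). For $z\in\mathbb{C}$, $$\rho_h(z)=\sum_{w\in Z_h\cup P_h,\ w\neq z}\left|\dfrac{\mathrm{mult}_h(w)}{z-w}\right|.$$ A critical point of a rational function $f$ is a point of $\mathbb{C}$ that is a zero of $f'$; its multiplicity is its multiplicity as a zero of $f'$, and numbers of critical points are counted with multiplicity. How large $R$ and how small $\epsilon$ must be depends on $g$; the constant $K$ depends on $g$, $R$ and $\epsilon$, but not on $h$. *)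

(* Defs.v *)
From HB Require Import structures.
From mathcomp Require Import all_boot all_order all_algebra generic_quotient fraction.
From mathcomp Require Import complex.
From mathcomp Require Import boolp classical_sets cardinality fsbigop reals.

Set Implicit Arguments.
Unset Strict Implicit.
Unset Printing Implicit Defensive.

Import Order.TTheory GRing.Theory Num.Theory.
Local Open Scope ring_scope.
Local Open Scope classical_set_scope.
Local Open Scope complex_scope.

Section RationalFunctions.
Variable R : realType.
Local Notation C := R[i].

Definition ratfun := {fraction {poly C}}.

Implicit Types (f h : ratfun) (z w : C).

(* Numerator and denominator of [f] in lowest terms (each determined up to a
   nonzero constant factor): [repr f] is some representative, not necessarily
   reduced.  For f = 0 the numerator is 0 and the denominator is a nonzero
   constant. *)
Definition rf_num f : {poly C} :=
  let r := repr f in \n_r %/ gcdp \n_r \d_r.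
Definition rf_den f : {poly C} :=
  let r := repr f in \d_r %/ gcdp \n_r \d_r.

Definition rf_zeros f : set C := [set w | root (rf_num f) w].
Definition rf_poles f : set C := [set w | root (rf_den f) w].

Definition rf_finite_at f z : Prop := ~ rf_poles f z.

(* The value f(z); meaningful only when [rf_finite_at f z]. *)
Definition rf_eval f z : C := (rf_num f).[z] / (rf_den f).[z].

(* Positive at a zero, negative at a pole, as at most one of the two terms is
   nonzero.  Meaningless for f = 0, where it is never used. *)
Definition rf_mult f w : int := (mup w (rf_num f))%:Z - (mup w (rf_den f))%:Z.

(* (p / q)' = (p' q - p q') / q^2 *)
Definition rf_deriv f : ratfun :=
  let p := rf_num f in let q := rf_den f in
  tofrac (p^`() * q - p * q^`()) / tofrac (q ^+ 2).

(* [Normc.normc] is the modulus as an element of R, whereas [`|_|] would be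
   valued in C. *)
Definition rho h z : R :=
  \sum_(w \in (rf_zeros h `|` rf_poles h) `\ z)
    Normc.normc ((rf_mult h w)%:~R / (z - w)).

Definition critical_points f : set C := rf_zeros (rf_deriv f).

(* When f is constant every point is critical, but none has a (finite)
   multiplicity. *)
Definition critical_point_mult f z (m : nat) : Prop :=
  [/\ rf_deriv f != 0, critical_points f z & rf_mult (rf_deriv f) z = m%:Z].

(* [f] has exactly [m] critical points in [A], counted with multiplicity.  The
   finiteness condition is needed since [\sum_(_ \in _)] is 0 by convention on
   an infinite support. *)
Definition num_critical_points f (A : set C) (m : nat) : Prop :=
  [/\ rf_deriv f != 0, finite_set (critical_points f `&` A) &
      \sum_(w \in critical_points f `&` A) rf_mult (rf_deriv f) w = m%:Z].

Definition within (eps : R) z : set C := [set w | Normc.normc (w - z) < eps].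

End RationalFunctions.

(* Main.v *)
(* (gh)' = gh (g'/g + h'/h), and a small rho_h(0) pushes all zeros and poles of
   h far away and makes h'/h uniformly small on |z| <= rad + 1.  Writing
   g'/g = A/B in lowest terms and h = a/b, the critical points of gh in that
   disk are, up to a factor shared with g', the roots of
   A a b + B (a' b - a b'), a small relative perturbation of A a b away from the
   roots of A.  Counting the roots is a form of Rouche's theorem on an annulus
   r <= |z - z0| <= 2 r free of roots: the geometric mean of |p| over the circle of
   radius s is const * s^n there, n being the number of roots inside (Jensen), so
   two polynomials whose ratio is close to 1 on both boundary circles have the same
   n.  The mean is discretised over the roots of X^N - s^N, N -> oo, which needs
   no integration. *)
From HB Require Import structures.
Require Import Defs.
From mathcomp Require Import all_boot all_order all_algebra generic_quotient fraction.
From mathcomp Require Import complex.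
From mathcomp Require Import boolp classical_sets cardinality fsbigop reals.
From mathcomp Require Import zify ring lra.
Import Order.TTheory GRing.Theory Num.Theory.
Local Open Scope ring_scope.
Local Open Scope classical_set_scope.

Set Implicit Arguments.
Unset Strict Implicit.
Unset Printing Implicit Defensive.

(* Locked because unification would otherwise unfold it to square roots. *)
HB.lock Definition modulus (R : realType) (z : R[i]) : R := Normc.normc z.

Local Notation nm := modulus.

(** Bernoulli's inequality for [b / a = 1 + t] makes the quotient of the powers grow at least
    linearly in [N]; [a = 0] is treated apart. *)
Lemma expr_dominates {R : realType} (c a b : R) : 0 <= a -> a < b ->
  exists N0, forall N, (N0 <= N)%N -> c * a ^+ N <= b ^+ N.
Proof.
move=> a0 ab; have [->|an0] := eqVneq a 0.
  by exists 1%N => -[//|N] _; rewrite expr0n mulr0 exprn_ge0 // (le_trans a0) // ltW.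
have {an0}a0 : 0 < a by rewrite lt_def an0.
pose t := b / a - 1.
have t0 : 0 < t by rewrite subr_gt0 ltr_pdivlMr // mul1r.
have bern N : 1 + N%:R * t <= (b / a) ^+ N.
  elim: N => [|N IH]; first by rewrite expr0 mul0r addr0.
  have e : b / a = 1 + t by rewrite /t addrC subrK.
  rewrite exprSr {2}e.
  apply: le_trans (ler_wpM2r _ IH); last by lra.
  rewrite -natr1; have : 0 <= N%:R * t * t by rewrite !mulr_ge0 // ltW.
  lra.
exists (Num.bound (`|c| / t)) => N leN.
rewrite -ler_pdivlMr ?exprn_gt0 // -expr_div_n.
apply: le_trans (bern N).
have : `|c| / t < N%:R.
  apply: lt_le_trans (archi_boundP _) _; first by rewrite divr_ge0 // ltW.
  by rewrite ler_nat.
rewrite ltr_pdivrMr // => h; apply: (le_trans (ler_norm c)); lra.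
Qed.

(** * The modulus on [R[i]] *)

Section Modulus.
Context {R : realType}.
Implicit Types (x y z : R[i]) (r : R).

Lemma nm_ge0 x : 0 <= nm x.
Proof. by rewrite modulus.unlock; case: x => a b; rewrite sqrtr_ge0. Qed.

Lemma nm_eq0 x : (nm x == 0) = (x == 0).
Proof.
rewrite modulus.unlock.
by apply/eqP/eqP => [/Normc.eq0_normc|->] //; rewrite Normc.normc0.
Qed.

Lemma nm0 : nm (0 : R[i]) = 0.
Proof. by apply/eqP; rewrite nm_eq0. Qed.

Lemma nm_gt0 x : (0 < nm x) = (x != 0).
Proof. by rewrite lt_def nm_ge0 nm_eq0 andbT. Qed.

Lemma nm1 : nm (1 : R[i]) = 1.
Proof. by rewrite modulus.unlock Normc.normc1. Qed.

Lemma nmM x y : nm (x * y) = nm x * nm y.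
Proof. by rewrite modulus.unlock Normc.normcM. Qed.

Lemma nmV x : nm x^-1 = (nm x)^-1.
Proof. by rewrite modulus.unlock Normc.normcV. Qed.

Lemma nmN x : nm (- x) = nm x.
Proof. by rewrite modulus.unlock normcN. Qed.

Lemma nmX x n : nm (x ^+ n) = nm x ^+ n.
Proof.
by elim: n => [|n IH]; rewrite ?nm1 // !exprS nmM IH.
Qed.

Lemma nm_prod (I : Type) (s : seq I) (f : I -> R[i]) :
  nm (\prod_(i <- s) f i) = \prod_(i <- s) nm (f i).
Proof. by apply: big_morph; [exact: nmM|exact: nm1]. Qed.

Lemma nmD x y : nm (x + y) <= nm x + nm y.
Proof. by rewrite modulus.unlock le_normcD. Qed.

Lemma nmB x y : nm (x - y) = nm (y - x).
Proof. by rewrite -nmN opprB. Qed.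

Lemma nm_le_sub x y : nm x - nm y <= nm (x - y).
Proof. by rewrite lerBlDr -{1}(subrK y x) nmD. Qed.

Lemma nm_sub_le x y : nm (x - y) <= nm x + nm y.
Proof. by rewrite -[X in _ <= _ + X]nmN nmD. Qed.

Lemma nm_real r : 0 <= r -> nm r%:C%C = r.
Proof. by move=> r0; rewrite modulus.unlock /= expr0n addr0 sqrtr_sqr ger0_norm. Qed.

Lemma nm_int (n : int) : nm (n%:~R : R[i]) = `|n|%:~R.
Proof.
rewrite modulus.unlock; case: n => n; first by rewrite -pmulrn normcMn Normc.normc1.
by rewrite NegzE mulrNz normcN normrN -pmulrn normcMn Normc.normc1.
Qed.

End Modulus.

(** * Rouche's theorem from discrete Jensen means *)

Section Rouche.
Context {R : realType}.
Implicit Types (z u v w : R[i]) (s t : seq R[i]) (p q : {poly R[i]}) (r : R).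

(** [U] lists the roots of X^N - r^N; evaluating this factorisation at [v] gives the product of the
    distances. *)
Lemma circle_points r N : 0 <= r -> (0 < N)%N ->
  exists U : seq R[i], [/\ size U = N, {in U, forall u, nm u = r} &
    forall v, \prod_(u <- U) nm (u - v) = nm (v ^+ N - (r%:C)%C ^+ N)].
Proof.
move=> r0 N0; pose P : {poly R[i]} := 'X^N - ((r%:C)%C ^+ N)%:P.
have [U defP] := closed_field_poly_normal P.
have mP : lead_coef P = 1 by apply/eqP; rewrite -monicE monicXnsubC.
rewrite mP scale1r in defP.
exists U; split.
- have := size_prod_XsubC U id; rewrite -defP size_XnsubC //.
  by case.
- move=> u uU; have : root P u by rewrite defP root_prod_XsubC.
  rewrite /root !hornerE subr_eq0 => /eqP uN.
  apply/eqP; rewrite -(@eqrXn2 _ N) ?nm_ge0 //.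
  by rewrite -nmX uN nmX nm_real.
- move=> v; under eq_bigr do rewrite nmB.
  rewrite -nm_prod; congr nm.
  have -> : v ^+ N - (r%:C)%C ^+ N = P.[v] by rewrite !hornerE.
  by rewrite defP horner_prod; apply: eq_bigr => u _; rewrite !hornerE.
Qed.

(** By [circle_points], the product of the distances from [v] to N equally spaced points of the
    circle; for |v| different from r and large N it is comparable to max(r, |v|)^N. *)
Definition circle_gap N r v : R := nm (v ^+ N - (r%:C)%C ^+ N).

Definition circle_prod N r s := \prod_(v <- s) circle_gap N r v.

Lemma circle_gap_ge0 N r v : 0 <= circle_gap N r v.
Proof. exact: nm_ge0. Qed.

Lemma circle_prod_ge0 N r s : 0 <= circle_prod N r s.
Proof. by apply: prodr_ge0 => *; exact: circle_gap_ge0. Qed.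

Lemma circle_prod_nil N r : circle_prod N r [::] = 1.
Proof. exact: big_nil. Qed.

Lemma circle_prod_cons N r v s :
  circle_prod N r (v :: s) = circle_gap N r v * circle_prod N r s.
Proof. exact: big_cons. Qed.

Lemma circle_gap_bounds N r v : 0 <= r ->
  [/\ nm v ^+ N - r ^+ N <= circle_gap N r v,
      r ^+ N - nm v ^+ N <= circle_gap N r v &
      circle_gap N r v <= nm v ^+ N + r ^+ N].
Proof.
move=> r0; rewrite /circle_gap.
have := nm_le_sub (v ^+ N) ((r%:C)%C ^+ N).
have := nm_le_sub ((r%:C)%C ^+ N) (v ^+ N).
have := nm_sub_le (v ^+ N) ((r%:C)%C ^+ N).
by rewrite (nmB ((r%:C)%C ^+ N)) !nmX nm_real.
Qed.

(* Its N-th root is a discrete geometric mean of |p| over |z - z0| = r. *)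
Lemma circle_prod_horner z0 r N : 0 <= r -> (0 < N)%N ->
  exists U : seq R[i], [/\ size U = N, {in U, forall u, nm u = r} &
    forall (c : R[i]) s,
      \prod_(u <- U) nm (c *: \prod_(w <- s) ('X - w%:P)).[z0 + u] =
      nm c ^+ N * circle_prod N r [seq w - z0 | w <- s]].
Proof.
move=> r0 N0; have [U [sU nU pU]] := circle_points r0 N0.
exists U; split=> // c s.
under eq_bigr => u _ do rewrite hornerZ horner_prod nmM nm_prod.
rewrite big_split /= big_const_seq count_predT sU iter_mulr_1; congr (_ * _).
rewrite exchange_big /= /circle_prod big_map; apply: eq_bigr => w _.
rewrite /circle_gap -pU; apply: eq_bigr => u _; rewrite !hornerE; congr nm; ring.
Qed.

Lemma prodr_le (I : eqType) (l : seq I) (f g : I -> R) (k : R) :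
  0 <= k -> {in l, forall i, 0 <= f i /\ f i <= k * g i} ->
  \prod_(i <- l) f i <= k ^+ size l * \prod_(i <- l) g i.
Proof.
move=> k0; elim: l => [|i l IH] h; first by rewrite !big_nil mulr1.
rewrite !big_cons /= exprS mulrACA; have [fi fgi] := h i (mem_head _ _).
have h' : {in l, forall i, 0 <= f i /\ f i <= k * g i}.
  by move=> j jl; apply: h; rewrite inE jl orbT.
apply: ler_pM => //; last exact: IH.
by rewrite big_seq prodr_ge0 // => j /h' [].
Qed.

(** Since a gap is comparable to max(r, |v|)^N, doubling the radius multiplies it by about 2^N for
    [v] inside both circles and by about 1 for [v] outside both. The factor 2 absorbs the error once
    the smaller of the two competing powers is at most a third of the larger. *)
Lemma circle_gap_growth r ρ v : 0 < r -> ρ = 2 * r -> nm v < r \/ ρ < nm v ->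
  exists N0, forall N, (N0 <= N)%N -> let b : nat := nm v < r in
   [/\ 0 < circle_gap N r v,
      2 ^+ (N * b) * circle_gap N r v <= 2 * circle_gap N ρ v &
      circle_gap N ρ v <= 2 * (2 ^+ (N * b) * circle_gap N r v)].
Proof.
move=> r0 ρE hv; have ρ0 : 0 <= ρ by rewrite ρE mulr_ge0 // ltW.
have pw N : [/\ ρ ^+ N = 2 ^+ N * r ^+ N, 0 < r ^+ N, 0 <= nm v ^+ N & 1 <= 2 ^+ N :> R].
  by rewrite ρE exprMn exprn_gt0 // exprn_ge0 ?nm_ge0 // exprn_ege1 ?ler1n.
case: hv => vr.
  have [N0 h] := expr_dominates 3 (nm_ge0 v) vr.
  exists N0 => N /h; rewrite vr /= muln1 => {}h.
  have [x1 x2 x3] := circle_gap_bounds N v (ltW r0).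
  have [y1 y2 y3] := circle_gap_bounds N v ρ0.
  have [ρN] := pw N; rewrite ρN in y1 y2 y3.
  move: (circle_gap N r v) (circle_gap N ρ v) (nm v ^+ N) (r ^+ N) (2 ^+ N)
     h x1 x2 x3 y1 y2 y3 => x y V Q e h x1 x2 x3 y1 y2 y3 Q0 V0 e1 {pw ρN}.
  have e0 : 0 <= e by lra.
  have h1 : e * x <= e * (V + Q) by rewrite ler_wpM2l.
  have h2 : e * (Q - V) <= e * x by rewrite ler_wpM2l.
  have h3 : 1 * V <= e * V by rewrite ler_wpM2r.
  have h4 : e * (3 * V) <= e * Q by rewrite ler_wpM2l.
  by split; lra.
have [N0 h] := expr_dominates 3 ρ0 vr.
exists N0 => N /h.
have -> /= : (nm v < r) = false by apply/negbTE; rewrite -leNgt; lra.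
rewrite muln0 expr0 mul1r => {}h.
have [x1 x2 x3] := circle_gap_bounds N v (ltW r0).
have [y1 y2 y3] := circle_gap_bounds N v ρ0.
have [ρN] := pw N; rewrite ρN in y1 y2 y3 h.
move: (circle_gap N r v) (circle_gap N ρ v) (nm v ^+ N) (r ^+ N) (2 ^+ N)
   h x1 x2 x3 y1 y2 y3 => x y V Q e h x1 x2 x3 y1 y2 y3 Q0 V0 e1 {pw ρN}.
have h3 : 1 * Q <= e * Q by rewrite ler_wpM2r // ltW.
by split; lra.
Qed.

(** A discrete Jensen formula: the growths of the gaps multiply, so the exponent counts the points
    inside, and each point costs one factor 2. *)
Lemma circle_prod_growth r ρ s : 0 < r -> ρ = 2 * r ->
  {in s, forall v, nm v < r \/ ρ < nm v} ->
  exists N0, forall N, (N0 <= N)%N ->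
  let n := count (fun v => (nm v < r)%R) s in
  [/\ 0 < circle_prod N r s,
      2 ^+ (N * n) * circle_prod N r s <= 2 ^+ size s * circle_prod N ρ s &
      circle_prod N ρ s <= 2 ^+ size s * (2 ^+ (N * n) * circle_prod N r s)].
Proof.
move=> r0 ρE; elim: s => [|v s IH] hs.
  exists 0%N => N _.
  by rewrite !circle_prod_nil /= muln0 expr0 !mulr1 ltr01 lexx.
have [|N1 {}IH] := IH; first by move=> w ws; apply: hs; rewrite inE ws orbT.
have [N2 hv] := circle_gap_growth r0 ρE (hs v (mem_head _ _)).
exists (maxn N1 N2) => N; rewrite geq_max => /andP[/IH + /hv].
rewrite !circle_prod_cons /= mulnDr exprD exprS.
have := circle_gap_ge0 N ρ v; have := circle_prod_ge0 N ρ s.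
move: (circle_gap N r v) (circle_gap N ρ v) (circle_prod N r s) (circle_prod N ρ s).
have : 0 <= 2 ^+ (N * count (fun v => (nm v < r)%R) s) :> R by rewrite exprn_ge0.
have : 0 <= 2 ^+ (N * (nm v < r)%R) :> R by rewrite exprn_ge0.
have : 0 <= 2 ^+ size s :> R by rewrite exprn_ge0.
move: (2 ^+ size s) (2 ^+ (N * (nm v < r)%R)) (2 ^+ (N * count _ s)).
move=> S F E S0 F0 E0 x y X Y Y0 y0 [X0 h1 h2] [x0 h3 h4].
rewrite (mulrACA F) (mulrACA 2 S y) (mulrACA 2 S (F * x)) mulr_gt0 //.
by split=> //; apply: ler_pM => //; rewrite mulr_ge0 // ltW.
Qed.

(* 5/3 = (1 + 1/4) / (1 - 1/4) is the distortion allowed by rouche; only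
   5/3 < 2 = ρ / r matters. *)
Lemma count_le_of_circle_prod r ρ s t : 0 < r -> ρ = 2 * r ->
  {in s, forall v, nm v < r \/ ρ < nm v} ->
  {in t, forall v, nm v < r \/ ρ < nm v} ->
  (forall N, (0 < N)%N -> circle_prod N ρ s * circle_prod N r t <=
     (5 / 3) ^+ N * (circle_prod N r s * circle_prod N ρ t)) ->
  (count (fun v => (nm v < r)%R) s <= count (fun v => (nm v < r)%R) t)%N.
Proof.
move=> r0 ρE /(circle_prod_growth r0 ρE) [N1 h1] /(circle_prod_growth r0 ρE) [N2 h2] hc.
rewrite leqNgt; apply/negP => lt_ts.
have h53 : 0 <= 5 / 3 :> R by lra.
have h53' : 5 / 3 < 2 :> R by lra.
(* An excess in the count for [s] gains a factor 2^N, which must beat (5/3)^N times the losses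
   2^(size s) and 2^(size t); the extra leading 2 makes the contradiction strict. *)
have [N3 h3] := expr_dominates (2 * 2 ^+ (size s + size t)) h53 h53'.
have [N [N0 lN1 lN2 lN3]] : exists N, [/\ 0 < N, N1 <= N, N2 <= N & N3 <= N]%N.
  by exists (N1 + N2 + N3).+1; split; lia.
have := h1 N lN1; have := h2 N lN2; have := h3 N lN3; have := hc N N0.
have lenm : 2 ^+ (N * (count (fun v => (nm v < r)%R) t).+1) <=
   2 ^+ (N * count (fun v => (nm v < r)%R) s) :> R.
  by rewrite ler_eXn2l ?leq_mul2l ?lt_ts ?orbT // ltr1n.
move: lenm; rewrite /= mulnS !exprD.
have : 0 < 2 ^+ size s :> R by rewrite exprn_gt0.
have : 0 < 2 ^+ size t :> R by rewrite exprn_gt0.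
have : 0 < (5 / 3) ^+ N :> R by rewrite exprn_gt0 //; lra.
have : 0 < 2 ^+ (N * count (fun v => (nm v < r)%R) t) :> R by rewrite exprn_gt0.
have : 0 < 2 ^+ N :> R by rewrite exprn_gt0.
move: (2 ^+ (N * count (fun v => (nm v < r)%R) t) : R).
move: (2 ^+ (N * count (fun v => (nm v < r)%R) s) : R) (2 ^+ N : R).
move: (2 ^+ size s : R) (2 ^+ size t : R) ((5 / 3) ^+ N : R)
  (circle_prod N r s) (circle_prod N ρ s)
  (circle_prod N r t) (circle_prod N ρ t).
move=> S T Q s1 s2 t1 t2 Em E En E0 En0 Q0 T0 S0 le_E le_c le_Q.
move=> [t10 le_t1 le_t2] [s10 le_s1 le_s2].
have c1 : (E * En) * (s1 * t1) <= S * (s2 * t1).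
  rewrite !mulrA ler_wpM2r ?(ltW t10) //; apply: le_trans le_s1.
  by rewrite ler_wpM2r ?(ltW s10).
have c2 : S * (s2 * t1) <= S * (Q * (s1 * (T * (En * t1)))).
  rewrite ler_wpM2l ?(ltW S0) //; apply: (le_trans le_c).
  by rewrite ler_wpM2l ?(ltW Q0) // ler_wpM2l ?(ltW s10).
have c3 : 2 * (S * T) * Q * (En * (s1 * t1)) <= E * (En * (s1 * t1)).
  by rewrite ler_wpM2r // !mulr_ge0 // ltW.
have c4 : 0 < S * T * Q * (En * (s1 * t1)) by rewrite !mulr_gt0.
lra.
Qed.

Definition roots_of p : seq R[i] := projT1 (closed_field_poly_normal p).

Lemma roots_ofE p : p = lead_coef p *: \prod_(w <- roots_of p) ('X - w%:P).
Proof. exact: (projT2 (closed_field_poly_normal p)). Qed.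

Lemma mem_roots_of p w : p != 0 -> (w \in roots_of p) = root p w.
Proof.
by move=> p0; rewrite [in RHS](roots_ofE p) rootZ ?lead_coef_eq0 // root_prod_XsubC.
Qed.

Lemma count_roots_of p w : p != 0 -> count_mem w (roots_of p) = mup w p.
Proof.
move=> p0; rewrite [in RHS](roots_ofE p) -mul_polyC mupMr ?mu_prod_XsubC //.
by rewrite rootC lead_coef_eq0.
Qed.

(** On the annulus |p| and |q| differ by factors at most 5/4 and 4/3. Multiplying over the circle
    points at both radii compares the growths of the two circle products, hence the numbers of roots
    inside. *)
Lemma rouche p q z0 r ρ : 0 < r -> ρ = 2 * r -> p != 0 -> q != 0 ->
  (forall z, r <= nm (z - z0) -> nm (z - z0) <= ρ ->
     q.[z] != 0 /\ nm (p.[z] - q.[z]) <= nm q.[z] / 4) ->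
  count (fun w => nm (w - z0) < ρ) (roots_of p) =
  count (fun w => nm (w - z0) < ρ) (roots_of q).
Proof.
move=> r0 ρE p0 q0 hpq.
have hpq' z : r <= nm (z - z0) -> nm (z - z0) <= ρ ->
   [/\ 0 < nm q.[z], nm p.[z] <= 5 / 4 * nm q.[z] & nm q.[z] <= 4 / 3 * nm p.[z]].
  move=> h1 h2; have [qz pqz] := hpq z h1 h2.
  have qz0 : 0 < nm q.[z] by rewrite nm_gt0.
  have := nm_le_sub p.[z] q.[z]; have := nm_le_sub q.[z] p.[z].
  rewrite (nmB q.[z]) => k1 k2; split=> //; lra.
have out (f : {poly R[i]}) : f != 0 ->
   (forall z, r <= nm (z - z0) -> nm (z - z0) <= ρ -> f.[z] != 0) ->
   {in [seq w - z0 | w <- roots_of f], forall v, nm v < r \/ ρ < nm v}.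
  move=> f0 hf v /mapP [w]; rewrite mem_roots_of // => /rootP fw ->.
  have [|h1] := ltP (nm (w - z0)) r; first by left.
  have [|h2] := ltP ρ (nm (w - z0)); first by right.
  by have := hf w h1 h2; rewrite fw eqxx.
have outq : {in [seq w - z0 | w <- roots_of q], forall v, nm v < r \/ ρ < nm v}.
  by apply: out => // z h1 h2; have [] := hpq z h1 h2.
have outp : {in [seq w - z0 | w <- roots_of p], forall v, nm v < r \/ ρ < nm v}.
  apply: out => // z h1 h2; have [k1 _ k2] := hpq' z h1 h2.
  by rewrite -nm_gt0; lra.
(* With no root in the closed annulus, counting below [ρ] and counting below [r] agree. *)
have cnt (f : {poly R[i]}) :
   {in [seq w - z0 | w <- roots_of f], forall v, nm v < r \/ ρ < nm v} ->
   count (fun w => nm (w - z0) < ρ) (roots_of f) =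
   count (fun v => (nm v < r)%R) [seq w - z0 | w <- roots_of f].
  move=> hf; rewrite count_map; apply: eq_in_count => w wf /=.
  have [|] := hf (w - z0) (map_f _ wf); first by move=> h; rewrite h; lra.
  by move=> h; apply/idP/idP => h'; lra.
have bounds N : (0 < N)%N -> forall a, r <= a -> a <= ρ ->
  nm (lead_coef p) ^+ N * circle_prod N a [seq w - z0 | w <- roots_of p] <=
  (5 / 4) ^+ N * (nm (lead_coef q) ^+ N * circle_prod N a [seq w - z0 | w <- roots_of q])
  /\ nm (lead_coef q) ^+ N * circle_prod N a [seq w - z0 | w <- roots_of q] <=
  (4 / 3) ^+ N * (nm (lead_coef p) ^+ N * circle_prod N a [seq w - z0 | w <- roots_of p]).
  move=> N0 a ra aρ; have a0 : 0 <= a by lra.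
  have [U [sU nU hU]] := circle_prod_horner z0 a0 N0.
  have on_circle u : u \in U ->
     nm p.[z0 + u] <= 5 / 4 * nm q.[z0 + u] /\ nm q.[z0 + u] <= 4 / 3 * nm p.[z0 + u].
    move=> uU; have nu : nm (z0 + u - z0) = a by rewrite addrC addKr nU.
    by have [||_ h1 h2] := hpq' (z0 + u); rewrite ?nu.
  rewrite -!hU -!roots_ofE -sU.
  split; apply: prodr_le => [|u /on_circle [h1 h2]]; lra.
(* [c] and [d] stand for the N-th powers of the leading coefficients; they cancel when a bound on
   one circle meets the reverse bound on the other. *)
have cross (c d x x' y y' k l : R) : 0 < c -> 0 < d -> 0 <= x -> 0 <= y ->
    d * x <= k * (c * x') -> c * y <= l * (d * y') -> x * y <= k * l * (y' * x').
  move=> c0 d0 x0 y0 h1 h2; rewrite -(ler_pM2l (mulr_gt0 d0 c0)).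
  have -> : d * c * (x * y) = (d * x) * (c * y) by ring.
  have -> : d * c * (k * l * (y' * x')) = (k * (c * x')) * (l * (d * y')) by ring.
  by apply: ler_pM => //; rewrite mulr_ge0 // ltW.
have e53 N : (5 / 3) ^+ N = (5 / 4) ^+ N * (4 / 3) ^+ N :> R.
  by rewrite -exprMn; congr (_ ^+ _); lra.
have lcp : 0 < nm (lead_coef p) by rewrite nm_gt0 lead_coef_eq0.
have lcq : 0 < nm (lead_coef q) by rewrite nm_gt0 lead_coef_eq0.
rewrite !cnt //; apply/eqP; rewrite eqn_leq; apply/andP; split.
all: apply: (count_le_of_circle_prod r0 ρE) => // N N0.
all: have [h1 h2] : _ /\ _ := bounds N N0 r (lexx _) ltac:(lra).
all: have [h3 h4] : _ /\ _ := bounds N N0 ρ ltac:(lra) (lexx _).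
- rewrite e53; exact: cross (exprn_gt0 N lcq) (exprn_gt0 N lcp)
    (circle_prod_ge0 _ _ _) (circle_prod_ge0 _ _ _) h3 h2.
- rewrite e53 (mulrC ((5 / 4) ^+ N)); exact: cross (exprn_gt0 N lcp)
    (exprn_gt0 N lcq) (circle_prod_ge0 _ _ _) (circle_prod_ge0 _ _ _) h4 h1.
Qed.

End Rouche.

(** * Rational functions: lowest terms against arbitrary representations *)

Lemma frac_repr (A : idomainType) (f : {fraction A}) :
  f = tofrac \n_(repr f) / tofrac \d_(repr f).
Proof.
rewrite -[LHS]reprK; move: (repr f) => x; unlock tofrac.
rewrite -[X in _ = _ * X]FracField.pi_inv -[RHS]FracField.pi_mul.
rewrite /FracField.mulf /FracField.invf /= !numden_Ratio ?oner_neq0 ?denom_ratioP //.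
by rewrite mulr1 mul1r Ratio_numden.
Qed.

Lemma mup_gt0 (F : fieldType) (p : {poly F}) w : p != 0 ->
  (0 < mup w p)%N = root p w.
Proof. by move=> p0; rewrite -XsubC_dvd // dvdp_XsubCl. Qed.

Section RatFun.
Context {R : realType}.
Implicit Types (f : ratfun R) (p q : {poly R[i]}) (w : R[i]).

(** The numerator of (p / q)' over q^2, before any cancellation. *)
Definition wronskian p q := p^`() * q - p * q^`().

Lemma rf_den_neq0 f : rf_den f != 0.
Proof.
by rewrite /rf_den dvdp_div_eq0 ?dvdp_gcdr // denom_ratioP.
Qed.

Lemma coprimep_rf f : coprimep (rf_num f) (rf_den f).
Proof.
rewrite /rf_num /rf_den; apply: coprimep_div_gcd.
by rewrite denom_ratioP orbT.
Qed.

Lemma rf_numden f : tofrac (rf_num f) / tofrac (rf_den f) = f.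
Proof.
rewrite [in RHS](frac_repr f) /rf_num /rf_den; set n := \n_ _; set d := \d_ _.
have d0 : d != 0 by rewrite denom_ratioP.
have g0 : gcdp n d != 0 by rewrite gcdp_eq0 negb_and d0 orbT.
have d1 : d %/ gcdp n d != 0 by rewrite dvdp_div_eq0 ?dvdp_gcdr.
apply/eqP; rewrite eqr_div ?tofrac_eq0 // -!tofracM tofrac_eq; apply/eqP.
by rewrite -{2}(divpK (dvdp_gcdr n d)) [_ %/ _ * gcdp _ _]mulrC mulrA divpK ?dvdp_gcdl.
Qed.

(** This relation transfers multiplicities and derivatives from the lowest terms to any
    representation. *)
Lemma rf_num_cross p q : q != 0 ->
  rf_num (tofrac p / tofrac q) * q = p * rf_den (tofrac p / tofrac q).
Proof.
set f := _ / _ => q0; apply/eqP; rewrite -tofrac_eq !tofracM.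
have := rf_numden f; rewrite {2}/f => /eqP.
by rewrite eqr_div ?tofrac_eq0 ?rf_den_neq0.
Qed.

Lemma rf_num_eq0 f : (rf_num f == 0) = (f == 0).
Proof.
apply/eqP/eqP => [e|->]; first by rewrite -(rf_numden f) e tofrac0 mul0r.
have := @rf_num_cross 0 1 (oner_neq0 _).
by rewrite tofrac0 !mul0r mulr1.
Qed.

(** Differentiating the cross relation [n * q = p * d] shows that the quotient rule does not depend
    on the representation. *)
Lemma rf_derivE p q : q != 0 ->
  rf_deriv (tofrac p / tofrac q : ratfun R) =
  tofrac (wronskian p q) / tofrac (q ^+ 2).
Proof.
move=> q0; rewrite /rf_deriv; set n := rf_num _; set d := rf_den _.
have d0 : d != 0 by exact: rf_den_neq0.
have e : n * q = p * d by exact: rf_num_cross.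
have e' : n^`() * q + n * q^`() = p^`() * d + p * d^`() by rewrite -!derivM e.
apply/eqP; rewrite eqr_div ?tofrac_eq0 ?expf_neq0 // -!tofracM tofrac_eq; apply/eqP.
rewrite /wronskian.
have -> : (n^`() * d - n * d^`()) * q ^+ 2 =
   (n^`() * q + n * q^`()) * d * q - (n * q) * (d^`() * q + d * q^`()) by ring.
by rewrite e e'; ring.
Qed.

Lemma rf_cross_mup p q w : p != 0 -> q != 0 ->
  let f : ratfun R := tofrac p / tofrac q in
  (mup w (rf_num f) + mup w q = mup w p + mup w (rf_den f))%N.
Proof.
move=> p0 q0 f; rewrite -!mupM ?rf_den_neq0 //; last first.
  by rewrite rf_num_eq0 mulf_neq0 ?invr_eq0 ?tofrac_eq0.
by rewrite rf_num_cross.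
Qed.

Lemma rf_mult_frac p q w : p != 0 -> q != 0 ->
  rf_mult (tofrac p / tofrac q : ratfun R) w = (mup w p)%:Z - (mup w q)%:Z.
Proof. by move=> p0 q0; rewrite /rf_mult; have /= := rf_cross_mup w p0 q0; lia. Qed.

Lemma rf_zeros_frac p q w : p != 0 -> q != 0 ->
  rf_zeros (tofrac p / tofrac q : ratfun R) w <-> (mup w q < mup w p)%N.
Proof.
move=> p0 q0; rewrite /rf_zeros /=; set f := _ / _.
have f0 : rf_num f != 0 by rewrite rf_num_eq0 mulf_neq0 ?invr_eq0 ?tofrac_eq0.
have := rf_cross_mup w p0 q0; rewrite -/f /= => e.
rewrite -mup_gt0 //; split=> h; last by lia.
have : ~~ root (rf_den f) w.
  by apply: contraTN h => h; rewrite -eqn0Ngt mupNroot // (coprimep_root _ h) //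
    coprimep_sym coprimep_rf.
by move=> /mupNroot; lia.
Qed.

End RatFun.

(** * Wronskians, logarithmic derivatives and [rho] *)

Section LogDerivative.
Context {R : realType}.
Implicit Types (h : ratfun R) (p q a b : {poly R[i]}) (z w : R[i]).

(** The product rule for (p / q)(a / b), read on unreduced numerators. *)
Lemma wronskianM p q a b :
  wronskian (p * a) (q * b) = wronskian p q * (a * b) + (p * q) * wronskian a b.
Proof. by rewrite /wronskian !derivM; ring. Qed.

Lemma wronskian_swap p q : wronskian q p = - wronskian p q.
Proof. by rewrite /wronskian; ring. Qed.

Lemma mupN p w : mup w (- p) = mup w p.
Proof.
by rewrite -mulN1r -polyCN mupMr // rootC oppr_eq0 oner_eq0.
Qed.

(** In characteristic 0, p' loses exactly one order at [w], while p q' keeps at least the full order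
    of p. *)
Lemma mup_wronskian p q w : p != 0 -> root p w -> ~~ root q w ->
  (mup w (wronskian p q)).+1 = mup w p.
Proof.
move=> p0 pw qw; have [[|k] [u]] := multiplicity_XsubC p w; rewrite p0 /= => uw ep.
  by move: pw; rewrite ep mulr1 (negbTE uw).
rewrite ep mupMr // mup_XsubCX eqxx; congr _.+1.
have -> : wronskian (u * ('X - w%:P) ^+ k.+1) q =
   (k.+1%:R%:P * u * q + ('X - w%:P) * wronskian u q) * ('X - w%:P) ^+ k.
  rewrite /wronskian derivM deriv_exp derivXsubC /= mul1r exprS -mulr_natl polyC_natr.
  ring.
rewrite mupMr; first by rewrite mup_XsubCX eqxx.
rewrite /root !hornerE subrr mul0r addr0 !mulf_eq0 pnatr_eq0 /=.
by rewrite negb_or uw qw.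
Qed.

(** The logarithmic derivative of p / q has a simple pole at each zero and pole. Only one of p, q
    vanishes at [w], and exchanging them just changes the sign. *)
Lemma mup_wronskian_coprime p q w : p != 0 -> q != 0 -> coprimep p q ->
  root (p * q) w -> (mup w (wronskian p q)).+1 = mup w (p * q).
Proof.
move=> p0 q0 pq; rewrite rootM => /orP[pw|qw].
  have qw : ~~ root q w by rewrite (coprimep_root pq).
  by rewrite mup_wronskian // mupM // (mupNroot qw) addn0.
have pw : ~~ root p w by rewrite (coprimep_root _ qw) // coprimep_sym.
by rewrite wronskian_swap mupN mup_wronskian // mupM // (mupNroot pw).
Qed.

(** The triangle inequality in a'/a = sum of 1/(z - v), by induction on the roots with a free
    constant factor. *)
Lemma nm_deriv_le a z : a.[z] != 0 ->
  nm a^`().[z] <= nm a.[z] * \sum_(v <- roots_of a) (nm (z - v))^-1.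
Proof.
rewrite {1 2 3}(roots_ofE a); elim: (roots_of a) (lead_coef a) => [|v s IH] c.
  by rewrite !big_nil alg_polyC derivC horner0 mulr0 nm0.
have e : c *: \prod_(w <- v :: s) ('X - w%:P) =
   (c *: \prod_(w <- s) ('X - w%:P)) * ('X - v%:P).
  by rewrite big_cons -scalerAl mulrC.
rewrite e big_cons; set P := c *: _ => PZ.
have {PZ} [Pz zv] : P.[z] != 0 /\ z - v != 0.
  by move: PZ; rewrite !hornerE mulf_eq0 negb_or => /andP.
have := IH c Pz; rewrite -/P; set S := \sum_(_ <- _) _ => le.
clearbody P; rewrite derivM derivXsubC mulr1 !hornerE.
apply: le_trans (nmD _ _) _; rewrite !nmM mulrDr.
have vz : nm (z - v) != 0 by rewrite nm_eq0.
rewrite mulfK // addrC lerD2l.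
by rewrite [leRHS]mulrAC ler_wpM2r ?nm_ge0.
Qed.

Lemma nm_wronskian_le a b z : a.[z] != 0 -> b.[z] != 0 ->
  nm (wronskian a b).[z] <= nm (a * b).[z] *
    \sum_(v <- roots_of a ++ roots_of b) (nm (z - v))^-1.
Proof.
move=> az bz; rewrite /wronskian big_cat /= !hornerE mulrDr.
apply: le_trans (nm_sub_le _ _) _; rewrite !nmM; apply: lerD.
  by rewrite mulrAC ler_wpM2r ?nm_ge0 ?nm_deriv_le.
by rewrite -mulrA ler_wpM2l ?nm_ge0 ?nm_deriv_le.
Qed.

(** Listing roots with repetition replaces each |mult| by that many equal terms; the excluded point
    0 is neither a zero nor a pole here. *)
Lemma rhoE h : h != 0 -> ~~ root (rf_num h) 0 -> ~~ root (rf_den h) 0 ->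
  rho h 0 = \sum_(v <- roots_of (rf_num h) ++ roots_of (rf_den h)) (nm v)^-1.
Proof.
move=> h0 n0 d0; set s := _ ++ _.
have hn : rf_num h != 0 by rewrite rf_num_eq0.
have hd := rf_den_neq0 h.
have ms w : w \in s = root (rf_num h) w || root (rf_den h) w.
  by rewrite mem_cat !mem_roots_of.
have s0 : 0 \notin s by rewrite ms negb_or n0.
rewrite /rho (fsbig_fwiden (undup s)) ?undup_uniq //=.
- rewrite -[RHS]big_undup_iterop_count /=; apply: eq_big_seq => w.
  rewrite mem_undup ms => hw.
  have -> : iterop (count_mem w s) +%R (nm w)^-1 0 = (nm w)^-1 *+ count_mem w s by [].
  have -> : @Normc.normc R = @modulus R by rewrite modulus.unlock.
  rewrite sub0r nmM nmV nmN nm_int count_cat !count_roots_of //.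
  (* By coprimality one of the two multiplicities is 0, so the modulus of their difference is their
     sum. *)
  have -> : `|rf_mult h w| = (mup w (rf_num h) + mup w (rf_den h))%N :> int.
    have cop := coprimep_rf h; rewrite /rf_mult; case/orP: hw => hw.
      by have /mupNroot -> := coprimep_root cop hw; lia.
    rewrite coprimep_sym in cop.
    by have /mupNroot -> := coprimep_root cop hw; lia.
  by rewrite -pmulrn mulr_natl.
- by move=> w [hw _] /=; rewrite mem_undup ms; apply/orP.
- move=> w [/=]; rewrite mem_undup ms => /orP hw; case; split=> // w0.
  by move: s0; rewrite -w0 ms; case: hw => ->; rewrite ?orbT.
Qed.
End LogDerivative.

(** * Perturbation estimates and root counts *)

Section Perturbation.
Context {R : realType}.
Implicit Types (p q a b : {poly R[i]}) (z w : R[i]) (T : seq R).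

Lemma poly_bounded_on_disk p (ρ : R) : 0 <= ρ ->
  exists2 M, 0 < M & forall z, nm z <= ρ -> nm p.[z] <= M.
Proof.
move=> ρ0; elim/poly_ind: p => [|p c [M M0 hM]].
  by exists 1 => // z _; rewrite horner0 nm0.
exists (M * ρ + nm c + 1) => [|z zρ].
  by rewrite ltr_wpDl // addr_ge0 ?nm_ge0 // mulr_ge0 // ltW.
rewrite !hornerE; apply: (le_trans (nmD _ _)); rewrite nmM.
have := ler_pM (nm_ge0 _) (nm_ge0 _) (hM z zρ) zρ; lra.
Qed.

(** Each linear factor contributes at least [d]. *)
Lemma horner_lower_bound p (d : R) : 0 < d -> p != 0 ->
  exists2 μ, 0 < μ &
    forall z, (forall w, root p w -> d <= nm (z - w)) -> μ <= nm p.[z].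
Proof.
move=> d0 p0; exists (nm (lead_coef p) * d ^+ size (roots_of p)).
  by rewrite mulr_gt0 ?exprn_gt0 // nm_gt0 lead_coef_eq0.
move=> z hz; rewrite [in leRHS](roots_ofE p) hornerZ nmM ler_wpM2l ?nm_ge0 //.
have {}hz : {in roots_of p, forall w, d <= nm (z - w)}.
  by move=> w; rewrite mem_roots_of // => /hz.
rewrite horner_prod nm_prod; elim: (roots_of p) hz => [|w s IH] hz.
  by rewrite big_nil.
rewrite big_cons exprS; apply: ler_pM; rewrite ?exprn_ge0 ?(ltW d0) //.
  by rewrite !hornerE hz ?mem_head.
by apply: IH => v vs; apply: hz; rewrite inE vs orbT.
Qed.

Lemma seq_pos_lower_bound T :
  exists2 e, 0 < e & {in T, forall x, 0 < x -> e <= x}.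
Proof.
elim: T => [|x T [e e0 he]]; first by exists 1.
have [x0|x0] := ltP 0 x.
  exists (Num.min e x) => [|y]; first by rewrite lt_min e0.
  by rewrite inE => /predU1P[->|/he h /h]; rewrite ge_min ?lexx ?orbT // => ->.
exists e => // y; rewrite inE => /predU1P[->|/he //]; lra.
Qed.

Lemma seq_upper_bound T :
  exists2 M, 1 <= M & {in T, forall x, x <= M}.
Proof.
elim: T => [|x T [M M1 hM]]; first by exists 1.
exists (Num.max M x) => [|y]; first by rewrite le_max M1.
by rewrite inE => /predU1P[->|/hM]; rewrite le_max ?lexx ?orbT // => ->.
Qed.

(** Provides the ratio 1/4 required by [rouche], with [K] fixed before [a] and [b]; [p / q] will be
    g'/g in lowest terms. *)
Lemma log_deriv_perturbation p q (ρ d : R) : 0 < ρ -> 0 < d -> p != 0 ->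
  exists2 K, 0 < K & forall a b, a != 0 -> b != 0 ->
    ~~ root a 0 -> ~~ root b 0 ->
    \sum_(v <- roots_of a ++ roots_of b) (nm v)^-1 < K ->
    forall z, nm z <= ρ -> (a * b).[z] != 0 /\
      ((forall w, root p w -> d <= nm (z - w)) ->
       (p * (a * b)).[z] != 0 /\
       nm (q * wronskian a b).[z] <= nm (p * (a * b)).[z] / 4).
Proof.
move=> ρ0 d0 p0.
have [μ μ0 hμ] := horner_lower_bound d0 p0.
have [M M0 hM] := poly_bounded_on_disk q (ltW ρ0).
(* The first bound pushes all roots v of [a] and [b] beyond 2ρ, so |z - v| >= |v|/2 and the sum of
   1/|z - v| is at most twice the given sum. The second then gives M * 2μ/(8M) = μ/4. *)
exists (Num.min (2 * ρ)^-1 (μ / (8 * M))).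
  by rewrite lt_min invr_gt0 divr_gt0 // mulr_gt0.
move=> a b a0 b0 ra rb; rewrite lt_min => /andP[sK1 sK2] z zρ.
set s := roots_of a ++ roots_of b in sK1 sK2.
have ms w : w \in s = root a w || root b w by rewrite mem_cat !mem_roots_of.
have far v : v \in s -> 0 < nm v /\ 2 * ρ < nm v.
  move=> vs; have v0 : 0 < nm v.
    rewrite nm_gt0; apply/eqP => v0; move: vs.
    by rewrite v0 ms (negbTE ra) (negbTE rb).
  split=> //; rewrite -ltf_pV2 ?posrE //; last by rewrite mulr_gt0.
  apply: le_lt_trans sK1; rewrite (perm_big _ (perm_to_rem vs)) big_cons /=.
  by rewrite lerDl sumr_ge0 // => *; rewrite invr_ge0 nm_ge0.
have zv v : v \in s -> nm v / 2 <= nm (z - v).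
  by move=> /far [v0 hv]; have := nm_le_sub v z; rewrite nmB; lra.
have nroot w : root a w || root b w -> w != z.
  rewrite -ms => ws; apply/eqP => wz; have [v0 _] := far w ws.
  by have := zv w ws; rewrite wz subrr nm0 -wz; lra.
have az : a.[z] != 0.
  by apply/negP => h; have := nroot z; rewrite /root h eqxx => /(_ isT).
have bz : b.[z] != 0.
  by apply/negP => h; have := nroot z; rewrite /root h orbT eqxx => /(_ isT).
have abz : (a * b).[z] != 0 by rewrite hornerM mulf_neq0.
split=> // hz; have {}hz := hμ z hz.
have pz : p.[z] != 0 by rewrite -nm_gt0 (lt_le_trans μ0).
split; first by rewrite hornerM mulf_neq0.
rewrite hornerM [in leRHS]hornerM !nmM.
apply: le_trans (ler_wpM2l (nm_ge0 _) (nm_wronskian_le az bz)) _.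
set S := \sum_(v <- _) _.
have S0 : 0 <= S by apply: sumr_ge0 => *; rewrite invr_ge0 nm_ge0.
have SK : S <= 2 * (μ / (8 * M)).
  apply: le_trans (ler_wpM2l _ (ltW sK2)); last by [].
  rewrite mulr_sumr /S big_seq [leRHS]big_seq; apply: ler_sum => v vs.
  have [v0 _] := far v vs; have := zv v vs => h.
  have zv0 : 0 < nm (z - v) by lra.
  rewrite -[leRHS]invrK lef_pV2 ?posrE // ?invr_gt0 ?mulr_gt0 ?invr_gt0 //.
  by rewrite invfM invrK mulrC.
have qM := hM z zρ.
have h : nm q.[z] * S <= μ / 4.
  apply: le_trans (ler_pM (nm_ge0 _) S0 qM SK) _.
  by rewrite le_eqVlt; apply/orP; left; apply/eqP; field; lra.
have qp : nm q.[z] * S <= nm p.[z] / 4 by lra.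
by rewrite mulrCA [_ * nm _ / 4]mulrAC [leRHS]mulrC ler_wpM2l ?nm_ge0.
Qed.

Lemma count_roots_of_mul (P : pred R[i]) p q : p != 0 -> q != 0 ->
  count P (roots_of (p * q)) = (count P (roots_of p) + count P (roots_of q))%N.
Proof.
move=> p0 q0; have : perm_eq (roots_of (p * q)) (roots_of p ++ roots_of q).
  apply/allP => w _ /=; apply/eqP.
  by rewrite count_cat !count_roots_of ?mulf_neq0 // mupM.
by move=> /permP ->; rewrite count_cat.
Qed.

Lemma count_roots_of_only (P : pred R[i]) p z : p != 0 -> P z ->
  (forall w, root p w -> P w -> w = z) -> count P (roots_of p) = mup z p.
Proof.
move=> p0 Pz hP; rewrite -count_roots_of //; apply: eq_in_count => w.
by rewrite mem_roots_of // => pw; apply/idP/eqP => [/(hP w pw)|->].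
Qed.

(** Links the sum over distinct points in [num_critical_points] to counting in a list with
    repetitions. *)
Lemma fsbig_mup (P : pred R[i]) p : p != 0 ->
  \sum_(w \in [set w | root p w /\ P w]) (mup w p)%:Z = (count P (roots_of p))%:Z.
Proof.
move=> p0; set s := [seq w <- roots_of p | P w].
have ms w : w \in s = P w && root p w by rewrite mem_filter mem_roots_of.
rewrite (fsbig_fwiden (undup s)) ?undup_uniq //=; first last.
- by move=> w [/=]; rewrite mem_undup ms => /andP[? ?] [].
- by move=> w [] /= pw Pw; rewrite mem_undup ms pw Pw.
rewrite -(big_morph Posz PoszD (erefl _)); congr Posz.
rewrite -size_filter -/s -sum1_size -[RHS]big_undup_iterop_count /=.
apply: eq_big_seq => w.
rewrite mem_undup ms => /andP[Pw _].
have -> : iterop (count_mem w s) addn 1%N 0%N = count_mem w s.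
  by rewrite Monoid.iteropE iter_addn_0 mul1n.
rewrite -count_roots_of // count_filter; apply: eq_count => x /=.
by case: eqP => [->|].
Qed.
End Perturbation.

(** * Critical points through Wronskians *)

Section Critical.
Context {R : realType}.
Implicit Types (f g h : ratfun R) (z w : R[i]).

Lemma critical_pointsE f w : rf_deriv f != 0 ->
  critical_points f w <->
  (mup w (rf_den f ^+ 2) < mup w (wronskian (rf_num f) (rf_den f)))%N.
Proof.
rewrite /critical_points /rf_deriv -/(wronskian _ _) => df.
apply: rf_zeros_frac; last by rewrite expf_neq0 // rf_den_neq0.
by apply: contraNneq df => ->; rewrite tofrac0 mul0r.
Qed.

Lemma wronskian_neq0 f : (rf_deriv f != 0) = (wronskian (rf_num f) (rf_den f) != 0).
Proof.
rewrite /rf_deriv -/(wronskian _ _) mulf_eq0 invr_eq0 !tofrac_eq0.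
by rewrite expf_eq0 /= (negbTE (rf_den_neq0 f)) orbF.
Qed.

Lemma rf_mulE g h : g * h =
  tofrac (rf_num g * rf_num h) / tofrac (rf_den g * rf_den h).
Proof. by rewrite -{1}(rf_numden g) -{1}(rf_numden h) mulf_div !tofracM. Qed.

Lemma rf_deriv_mulE g h : let q := rf_den g * rf_den h in
  rf_deriv (g * h) = tofrac (wronskian (rf_num g * rf_num h) q) / tofrac (q ^+ 2).
Proof. by rewrite /= {1}rf_mulE rf_derivE // mulf_neq0 // rf_den_neq0. Qed.

Lemma withinE (eps : R) z w : within eps z w = (nm (w - z) < eps) :> Prop.
Proof. by rewrite /within /= modulus.unlock. Qed.

End Critical.

(** * Choice of constants, local count near critical points of [g], exclusion elsewhere *)

Unset Implicit Arguments.

Theorem theorem3 (R : realType) (g : ratfun R) :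
  exists2 R0 : R, 0 < R0 &
  exists2 eps0 : R, 0 < eps0 &
  forall rad eps : R, R0 <= rad -> 0 < eps -> eps <= eps0 ->
  exists2 K : R, 0 < K &
  forall h : ratfun R,
    rho h 0 < K -> rf_finite_at h 0 -> rf_eval h 0 != 0 ->
    (forall (z : R[i]) (m : nat), critical_point_mult g z m ->
       num_critical_points (g * h) (within eps z) m) /\
    (forall z : R[i], critical_points (g * h) z ->
       Normc.normc z <= rad ->
       exists2 w : R[i], critical_points g w & within eps w z).
Proof.
(* For constant [g] no critical point has a multiplicity, so the first item is vacuous; every point
   is critical, so [z] itself serves in the second. *)
have [dg|dg] := eqVneq (rf_deriv g) 0.
  exists 1 => //; exists 1 => // rad eps _ eps0 _; exists 1 => // h _ _ _.
  split=> [z m []|z _ _]; first by rewrite dg eqxx.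
  exists z; last by rewrite withinE subrr nm0.
  rewrite /critical_points /rf_zeros /= dg.
  have /eqP -> : rf_num (0 : ratfun R) == 0 by rewrite rf_num_eq0.
  exact: root0.
have critE w := critical_pointsE w dg.
have W0 : wronskian (rf_num g) (rf_den g) != 0 by rewrite -wronskian_neq0.
have q0 := rf_den_neq0 g; have pq := coprimep_rf g.
have dE : rf_deriv g = tofrac (wronskian (rf_num g) (rf_den g)) / tofrac (rf_den g ^+ 2) by [].
have mE h := rf_deriv_mulE g h.
move: (rf_num g) (rf_den g) W0 q0 pq dE mE critE => p q; set W := wronskian p q.
move=> W0 q0 pq dE mE critE.
have p0 : p != 0.
  by apply: contraNneq W0 => p0; rewrite /W p0 /wronskian derivC !mul0r subr0.
(* A / B is g'/g in lowest terms. *)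
pose D := gcdp W (p * q); pose A := W %/ D; pose B := (p * q) %/ D.
have WE : W = A * D by rewrite divpK ?dvdp_gcdl.
have pqE : p * q = B * D by rewrite divpK ?dvdp_gcdr.
have AB : coprimep A B by apply: coprimep_div_gcd; rewrite W0.
have D0 : D != 0 by move: W0; rewrite WE mulf_eq0 negb_or => /andP[].
have A0 : A != 0 by move: W0; rewrite WE mulf_eq0 negb_or => /andP[].
have pq0 : p * q != 0 by rewrite mulf_neq0.
have B0 : B != 0 by move: pq0; rewrite pqE mulf_eq0 negb_or => /andP[].
have mupq w : mup w (q ^+ 2) = (mup w q + mup w q)%N by rewrite expr2 mupM.
have q20 : q ^+ 2 != 0 by rewrite expf_neq0.
have mupW w : mup w W = (mup w A + mup w D)%N by rewrite WE mupM.
(* At a pole of order k, W has order k - 1, below the order 2k of q^2. *)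
have crit_notpole w : critical_points g w -> ~~ root q w.
  move/critE; apply: contraTN => qw.
  have := mup_wronskian_coprime p0 q0 pq (w := w); rewrite rootM qw orbT => /(_ isT).
  have pw : ~~ root p w by apply: (coprimep_root _ qw); rewrite coprimep_sym.
  by rewrite mupM // (mupNroot pw) mupq -/W; clear; lia.
(* At a root of A, B is nonzero, so D carries the full order of p q. A pole there would give W an
   order one less than that of its divisor D. *)
have rootA_crit w : root A w -> critical_points g w.
  move=> Aw; apply/critE.
  have Bw := coprimep_root AB Aw.
  have mA : (0 < mup w A)%N by rewrite mup_gt0.
  have qw : ~~ root q w.
    apply/negP => qw.
    have := mup_wronskian_coprime p0 q0 pq (w := w); rewrite rootM qw orbT => /(_ isT).
    by rewrite -/W pqE mupMr // mupW; move: mA; clear; lia.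
  by rewrite mupq (mupNroot qw) mupW; move: mA; clear; lia.
(* The roots of W q include all critical points and poles of [g]; [M] bounds them and [e] separates
   them. *)
have [M M1 hM] := seq_upper_bound [seq nm w | w <- roots_of (W * q)].
have [e e0 he] := seq_pos_lower_bound
  [seq nm (w - v) | w <- roots_of (W * q), v <- roots_of (W * q)].
have Wq0 : W * q != 0 by rewrite mulf_neq0.
have sepWq v w : root (W * q) v -> root (W * q) w -> v != w -> e <= nm (v - w).
  move=> Wv Ww vw; apply: he; last by rewrite nm_gt0 subr_eq0.
  by apply: allpairs_f; rewrite mem_roots_of.
have bndWq v : root (W * q) v -> nm v <= M.
  by move=> Wv; apply/hM/map_f; rewrite mem_roots_of.
exists M; first by lra.
(* The bound e/2 isolates each root of W q in its disk; the bound 1 keeps these disks within radius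
   rad + 1. *)
exists (Num.min (e / 2) 1); first by rewrite lt_min; apply/andP; split; lra.
move=> rad eps Mrad eps0; rewrite le_min => /andP[eps_e eps1].
have rad1 : 0 < rad + 1 by lra.
have eps2 : 0 < eps / 2 by lra.
(* eps/2 is the inner radius of the annulus later given to [rouche]. *)
have [K K0 hK] := log_deriv_perturbation B rad1 eps2 A0.
exists K; first exact: K0.
move=> h rhoK hd hn0.
have da0 : ~~ root (rf_den h) 0 by apply/negP.
have na0 : ~~ root (rf_num h) 0.
  by move: hn0; rewrite /rf_eval mulf_eq0 negb_or => /andP[].
have h0 : h != 0.
  by apply: contraNneq na0 => /eqP; rewrite -rf_num_eq0 => /eqP ->; exact: root0.
rewrite (rhoE h0 na0 da0) in rhoK.
have a0 : rf_num h != 0 by rewrite rf_num_eq0.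
have b0 := rf_den_neq0 h.
have {}hK := hK _ _ a0 b0 na0 da0 rhoK.
have {mE} := mE h; rewrite /= wronskianM -/W.
move: (rf_num h) (rf_den h) a0 b0 hK {na0 da0 hd hn0 rhoK} => a b a0 b0 hK.
(* D P / (q b)^2 is the derivative of g h. *)
pose P := A * (a * b) + B * wronskian a b.
have -> : W * (a * b) + p * q * wronskian a b = D * P by rewrite WE pqE /P; ring.
move=> mE.
have Pneq0 z : nm z <= rad + 1 ->
    (forall w, root A w -> eps / 2 <= nm (z - w)) -> P.[z] != 0.
  move=> zr hz; have [_ /(_ hz) [Q0 le]] := hK z zr.
  rewrite -nm_gt0 /P hornerD; have := nm_le_sub (A * (a * b)).[z] (- (B * wronskian a b).[z]).
  by rewrite opprK nmN; rewrite -nm_gt0 in Q0; lra.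
have ab_nroot z : nm z <= rad + 1 -> ~~ root a z /\ ~~ root b z.
  by move=> /hK [+ _]; rewrite hornerM mulf_eq0 negb_or => /andP.
have Q2 : (q * b) ^+ 2 != 0 by rewrite expf_neq0 ?mulf_neq0.
split.
  move=> z m [_ zc]; have qz := crit_notpole z zc.
  rewrite dE (rf_mult_frac z W0 q20) mupq (mupNroot qz) subr0 => -[mz].
  have Wz : root W z by rewrite -mup_gt0 //; move/critE: zc; exact: leq_ltn_trans.
  have Wqz : root (W * q) z by rewrite rootM Wz.
  have zM := bndWq z Wqz.
  have only v : root (W * q) v -> nm (v - z) < eps -> v = z.
    move=> Wv vz; apply/eqP; apply: contraTT vz => vz.
    by have := sepWq v z Wv Wqz vz; rewrite -leNgt; lra.
  have in_disk v : nm (v - z) <= eps -> nm v <= rad + 1.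
    by move=> vz; have := nmD z (v - z); rewrite addrC subrK; lra.
  (* For w other than z, |v - w| >= e - eps >= eps, because eps <= e/2. *)
  have farA v : eps / 2 <= nm (v - z) -> nm (v - z) <= eps ->
      forall w, root A w -> eps / 2 <= nm (v - w).
    move=> v1 v2 w Aw; have [->//|wz] := eqVneq w z.
    have Ww : root (W * q) w by rewrite WE !rootM Aw.
    have := sepWq w z Ww Wqz wz; have := nmD (w - v) (v - z).
    by rewrite addrA subrK (nmB w v); lra.
  (* The point z + eps on the outer circle witnesses that P is nonzero. *)
  have P0 : P != 0.
    have ze : nm (z + (eps%:C)%C - z) = eps by rewrite addrC addKr nm_real // ltW.
    have : P.[z + (eps%:C)%C] != 0.
      by apply: Pneq0; [apply: in_disk; rewrite ze|apply: farA; rewrite ze; lra].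
    by apply: contraNneq => ->; rewrite horner0.
  have eE : eps = 2 * (eps / 2) by lra.
  have Aab0 : A * (a * b) != 0 by rewrite !mulf_neq0.
  have rou : count (fun w => nm (w - z) < eps) (roots_of P) =
             count (fun w => nm (w - z) < eps) (roots_of (A * (a * b))).
    apply: (rouche eps2 eE P0 Aab0) => v v1 v2.
    have [_ /(_ (farA v v1 v2)) [Q0 le]] := hK v (in_disk v v2).
    by split=> //; rewrite /P hornerD addrC addKr.
  have DP0 : D * P != 0 by rewrite mulf_neq0.
  have zz : nm (z - z) < eps by rewrite subrr nm0.
  have [az bz] := ab_nroot z (in_disk z (ltW zz)).
  (* In the disk D can vanish only at z, and A a b likewise since a and b have no root there; the
     orders of D and A at z add up to that of W, which is m. *)
  have cnt : count (fun w => nm (w - z) < eps) (roots_of (D * P)) = m.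
    rewrite count_roots_of_mul // rou (@count_roots_of_only _ _ D z) //; last first.
      by move=> w Dw; apply: only; rewrite WE !rootM Dw orbT.
    rewrite (@count_roots_of_only _ _ (A * (a * b)) z) //; last first.
      move=> w + wz; have [aw bw] := ab_nroot w (in_disk w (ltW wz)).
      rewrite !rootM (negbTE aw) (negbTE bw) !orbF => Aw.
      by apply: only => //; rewrite WE !rootM Aw.
    by rewrite mupMl ?rootM ?negb_or ?az // addnC -mupW.
  (* Neither b nor q vanishes in the disk, so the order of (gh)' there is that of D P. *)
  have notpole w : within eps z w -> mup w ((q * b) ^+ 2) = 0%N.
    rewrite withinE => wz; have [_ bw] := ab_nroot w (in_disk w (ltW wz)).
    apply: mupNroot; rewrite expr2 !rootM (negbTE bw) !orbF orbb.
    apply/negP => qw; have Wqw : root (W * q) w by rewrite rootM qw orbT.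
    by have wz' := only w Wqw wz; move: qz; rewrite -wz' qw.
  have critM : critical_points (g * h) `&` within eps z =
      [set w | root (D * P) w /\ nm (w - z) < eps].
    apply/seteqP; split=> w [].
      move=> cw wz; split; last by rewrite -withinE.
      move: cw; rewrite /critical_points mE => /rf_zeros_frac.
      by rewrite notpole // mup_gt0 //; apply.
    move=> rw wz; have {}wz : within eps z w by rewrite withinE.
    split=> //; rewrite /critical_points mE; apply/rf_zeros_frac => //.
    by rewrite notpole // mup_gt0.
  split.
  - by rewrite mE mulf_neq0 ?invr_eq0 ?tofrac_eq0.
  - rewrite critM; apply: (sub_finite_set (B := [set` roots_of (D * P)])) => //.
    by move=> w [rw _] /=; rewrite mem_roots_of.
  rewrite -cnt -fsbig_mup // critM; apply: eq_fsbigr => w.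
  rewrite inE => -[_ wz].
  by rewrite mE rf_mult_frac // notpole ?subr0 // withinE.
move=> z zc zr; have {}zr : nm z <= rad by rewrite modulus.unlock.
have [//|nex] := pselect (exists2 w, critical_points g w & within eps w z).
have far w : critical_points g w -> eps <= nm (z - w).
  by move=> cw; rewrite leNgt; apply/negP => zw; apply: nex; exists w; rewrite ?withinE.
have zr1 : nm z <= rad + 1 by lra.
have Pz : P.[z] != 0.
  by apply: Pneq0 => // w /rootA_crit /far; lra.
have P0 : P != 0 by apply: contraNneq Pz => ->; rewrite horner0.
have [az bz] := ab_nroot z zr1.
have Az : ~~ root A z.
  by apply/negP => /rootA_crit /far; rewrite subrr nm0; lra.
(* As P, A and b are nonzero at z, the orders of both (gh)' and g' at z reduce to that of D minus
   twice that of q; z would then be critical for [g], at distance 0 from itself. *)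
have : critical_points g z.
  apply/critE; move: zc; rewrite /critical_points mE => /rf_zeros_frac.
  move=> /(_ (mulf_neq0 D0 P0) Q2).
  rewrite (mupMl _ Pz) expr2 mupM ?mulf_neq0 // mupMl // mupq mupW (mupNroot Az).
  by [].
by move/far; rewrite subrr nm0; lra.
Qed.
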